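(* Let $n>3$ and let $p$ be a permutation pattern. If $p$ is periodic for $3$, then $p$ is periodic for $n$.
   Context: An affine permutation of size $n$ is a bijection $w:\mathbb{Z}\to\mathbb{Z}$ with $w(i+n)=w(i)+n$ for all $i$ and $w(1)+\cdots+w(n)=\binom{n+1}{2}$; $\widetilde{S}_n$ is the group of these, generated by $s_0,\dots,s_{n-1}$ where $ws_i$ swaps the values at positions $i+mn$ and $i+1+mn$ for all $m$; $\ell(w)$ is the minimal number of generators in a factorization. $w$ contains $p\in S_k$ if there exist integers $i_1<\cdots<i_k$ with $w(i_1),\dots,w(i_k)$ in the same relative order as $p_1,\dots,p_k$, otherwise avoids $p$. With $F_{p,n}(x)=\sum_{w\in\widetilde{S}_n,\,w\text{ avoids }p}x^{\ell(w)}=\sum_ia_ix^i$, $p$ is periodic for $n$ if there exist $N\ge1$ and $i_0$ with $a_i=a_{i-N}$ for all $i\ge i_0$. *)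

(* Defs.v *)
From HB Require Import structures.
From mathcomp Require Import all_boot all_order all_algebra all_fingroup.
Set Implicit Arguments. Unset Strict Implicit. Unset Printing Implicit Defensive.
Import Order.TTheory GRing.Theory Num.Theory.
Local Open Scope ring_scope.

Definition is_affine_perm (n : nat) (w : int -> int) : Prop :=
  [/\ bijective w,
      (forall i : int, w (i + n%:Z) = w i + n%:Z) &
      \sum_(1 <= i < n.+1) w i%:Z = ('C(n.+1, 2))%:Z].

(* The generator s_i (i = 0..n-1) of the affine symmetric group, viewed as
   the affine permutation swapping i+mn and i+1+mn for all m. *)
Definition gen (n : nat) (i : 'I_n) (j : int) : int :=
  if ((j - (i : nat)%:Z) %% n%:Z)%Z == 0 then j + 1
  else if ((j - (i : nat)%:Z - 1) %% n%:Z)%Z == 0 then j - 1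
  else j.

(* The product s_{i_1} s_{i_2} ... s_{i_k} of generators, as a function
   (w s_i acts by precomposition: (w s_i)(j) = w(s_i j)). *)
Definition gen_prod (n : nat) (ws : seq 'I_n) : int -> int :=
  foldr (fun i f => gen i \o f) id ws.

Definition factors_in (n : nat) (w : int -> int) (k : nat) : Prop :=
  exists ws : seq 'I_n, size ws = k /\ (forall j, w j = gen_prod ws j).

Definition aff_length (n : nat) (w : int -> int) (k : nat) : Prop :=
  factors_in n w k /\ (forall k', (k' < k)%N -> ~ factors_in n w k').

Definition contains (k : nat) (p : 'S_k) (w : int -> int) : Prop :=
  exists idx : 'I_k -> int,
    (forall a b : 'I_k, (a < b)%N -> idx a < idx b) /\
    (forall a b : 'I_k, (w (idx a) < w (idx b)) = (p a < p b)%N).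

Definition avoids (k : nat) (p : 'S_k) (w : int -> int) : Prop :=
  ~ contains p w.

(* The window [w(1); ...; w(n)], which determines an affine permutation. *)
Definition window (n : nat) (w : int -> int) : seq int :=
  [seq w i%:Z | i <- iota 1 n].

(* coeff n p i c : a_i = c, i.e. exactly c affine permutations of size n of
   length i avoid p (counted through their windows, which determine them). *)
Definition coeff (n k : nat) (p : 'S_k) (i c : nat) : Prop :=
  exists L : seq (seq int),
    [/\ uniq L, size L = c &
        forall v : seq int,
          v \in L <-> exists w, [/\ is_affine_perm n w, avoids p w,
                                    aff_length n w i & window n w = v]].

Definition periodic (n k : nat) (p : 'S_k) : Prop :=
  exists N i0 : nat, (1 <= N)%N /\
    forall i : nat, (i0 <= i)%N ->
      forall c : nat, coeff n p i c <-> coeff n p (i - N) c.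

(* Main.v *)
Require Import Defs.
From HB Require Import structures.
From mathcomp Require Import all_boot all_order all_algebra all_fingroup.
From mathcomp Require Import boolp zify.
Set Implicit Arguments. Unset Strict Implicit. Unset Printing Implicit Defensive.
Import Order.TTheory GRing.Theory Num.Theory.
Local Open Scope ring_scope.

(** Write an affine permutation as w(1 + j + nq) = 1 + s_j + n(h_j + q) with s
    a permutation of {0,..,n-1} and h an integer vector of sum zero.  For fixed
    s, containing p amounts to the solvability of finitely many systems of
    difference constraints, hence to a boolean combination of affine
    inequalities in h whose linear parts have zero sum; and the length is
    sum_(i < j) |h_j - h_i - [s_j < s_i]| (Shi).

    For n = 3 periodicity bounds the number of avoiders of each length.  If an
    avoider were far from all the hyperplanes involved, it could be moved a long
    way along a permutation of (1,-2,1), keeping both its length and the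
    avoidance of p; so h is within a fixed distance of one of finitely many
    planes.  For general n, three residue classes of an avoider standardize to
    an avoider of size 3, so any three coordinates of h nearly satisfy one of finitely many
    linear relations.  Consequently h = h0 + m r with h0 and r bounded and the
    length growth N of r fixed.  Far out on such a ray avoidance does not depend
    on m and r is determined by h, so h |-> h + r is a bijection from the
    avoiders of length i - N to those of length i. *)

(** * The length is the inversion number *)

Lemma divz_digit (n r : nat) (q : int) :
  (r < n.+1)%N -> ((r%:Z + n.+1%:Z * q) %/ n.+1%:Z)%Z = q.
Proof. by move=> rn; rewrite addrC mulrC divzMDl // divz_small ?addr0; lia. Qed.

Lemma modz_digit (n r : nat) (q : int) :
  (r < n.+1)%N -> ((r%:Z + n.+1%:Z * q) %% n.+1%:Z)%Z = r.
Proof. by move=> rn; rewrite addrC mulrC modzMDl modz_small; lia. Qed.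

Lemma digit_exists (n : nat) (x : int) :
  exists (r : 'I_n.+1) (q : int), x = (r : nat)%:Z + n.+1%:Z * q.
Proof.
have lt_r : (`|(x %% n.+1%:Z)%Z| < n.+1)%N.
  have := @ltz_mod x n.+1%:Z isT; have := @modz_ge0 x n.+1%:Z isT; lia.
exists (Ordinal lt_r), (x %/ n.+1%:Z)%Z => /=.
have := divz_eq x n.+1%:Z; have := @modz_ge0 x n.+1%:Z isT; lia.
Qed.

Lemma digit_uniq (n r r' : nat) (q q' : int) :
  (r < n.+1)%N -> (r' < n.+1)%N ->
  r%:Z + n.+1%:Z * q = r'%:Z + n.+1%:Z * q' -> r = r' /\ q = q'.
Proof.
move=> lr lr' e; split; last by rewrite -(divz_digit q lr) e divz_digit.
by have := modz_digit q lr; rewrite e modz_digit // => -[].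
Qed.

Lemma ltz_digit (n r r' : nat) (q q' : int) :
  (r < n.+1)%N -> (r' < n.+1)%N ->
  (r%:Z + n.+1%:Z * q < r'%:Z + n.+1%:Z * q') = (q <= q' - (r' <= r)%N%:Z).
Proof. by case: (leqP r' r) => ? ? ?; apply/idP/idP; nia. Qed.

Lemma divz_sub_digit (n r r' : nat) (q q' : int) :
  (r < n.+1)%N -> (r' < n.+1)%N ->
  (((r'%:Z + n.+1%:Z * q') - (r%:Z + n.+1%:Z * q)) %/ n.+1%:Z)%Z
    = q' - q - (r' < r)%N%:Z.
Proof.
move=> lr lr'; case: (ltnP r' r) => rr.
  have -> : (r'%:Z + n.+1%:Z * q') - (r%:Z + n.+1%:Z * q)
    = (r' + n.+1 - r)%N%:Z + n.+1%:Z * (q' - q - 1) by lia.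
  by rewrite divz_digit //; lia.
have -> : (r'%:Z + n.+1%:Z * q') - (r%:Z + n.+1%:Z * q)
  = (r' - r)%N%:Z + n.+1%:Z * (q' - q) by lia.
by rewrite divz_digit; lia.
Qed.

Lemma is_affine_shift (n : nat) (w : int -> int) :
  (forall i : int, w (i + n%:Z) = w i + n%:Z) ->
  forall i q : int, w (i + n%:Z * q) = w i + n%:Z * q.
Proof.
move=> per i q.
have pos (m : nat) (j : int) : w (j + n%:Z * m%:Z) = w j + n%:Z * m%:Z.
  elim: m j => [|m IH] j; first by rewrite mulr0 !addr0.
  have -> : j + n%:Z * m.+1%:Z = j + n%:Z + n%:Z * m%:Z by lia.
  by rewrite IH per; lia.
case: q => m; first exact: pos.
have := pos m.+1 (i + n%:Z * Negz m).
have -> : i + n%:Z * Negz m + n%:Z * m.+1%:Z = i by lia.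
by move=> ->; lia.
Qed.

(* Shi's inversion number. *)
Definition inversions (n : nat) (w : int -> int) : nat :=
  \sum_(xy : 'I_n * 'I_n | (xy.1 < xy.2)%N)
    absz ((w xy.2.+1%:Z - w xy.1.+1%:Z)%R %/ n%:Z)%Z.

Definition digit_inversions (n : nat) (q : 'I_n -> int) (r : 'I_n -> nat) : nat :=
  \sum_(xy : 'I_n * 'I_n | (xy.1 < xy.2)%N)
    absz (q xy.2 - q xy.1 - (r xy.2 < r xy.1)%N%:Z)%R.

Lemma inversions_digit (n : nat) (w : int -> int) (i : int)
    (q : 'I_n.+1 -> int) (r : 'I_n.+1 -> nat) :
  (forall x, (r x < n.+1)%N) ->
  (forall x : 'I_n.+1, w (x : nat).+1%:Z = i + ((r x)%:Z + n.+1%:Z * q x)) ->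
  inversions n.+1 w = digit_inversions q r.
Proof.
move=> lr wE; apply: eq_bigr => -[x y] _ /=; rewrite !wE.
by rewrite opprD addrACA subrr add0r divz_sub_digit.
Qed.

(** The generator [gen i] in digits counted from [i]: residues 0 and 1 are exchanged and the
    quotient is kept, with no wrap-around, whichever [i] is. *)
Definition swap01 (r : nat) : nat := if r is 0%N then 1%N else if r is 1%N then 0%N else r.


Lemma gen_digit (n : nat) (i : 'I_n.+2) (r : nat) (q : int) :
  (r < n.+2)%N ->
  gen i ((i : nat)%:Z + (r%:Z + n.+2%:Z * q)) = (i : nat)%:Z + ((swap01 r)%:Z + n.+2%:Z * q).
Proof.
move=> lr; rewrite /gen [X in ((X %% _)%Z == 0)](_ : _ = r%:Z + n.+2%:Z * q); last lia.
rewrite modz_digit //; case: r lr => [|r] lr /=; first lia.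
rewrite [X in ((X %% _)%Z == 0)](_ : _ = r%:Z + n.+2%:Z * q); last lia.
by rewrite modz_digit ?(ltnW lr) //; case: r lr => [|r] lr /=; lia.
Qed.

Lemma genK (n : nat) (i : 'I_n.+2) : involutive (gen i).
Proof.
move=> x; have [r [q e]] := digit_exists n.+1 (x - (i : nat)%:Z).
have {e}-> : x = (i : nat)%:Z + ((r : nat)%:Z + n.+2%:Z * q) by lia.
have ls : (swap01 r < n.+2)%N by case: r => [[|[|r]]].
by rewrite !gen_digit //; case: r {ls} => [[|[|r]]].
Qed.

Lemma gen_shift (n : nat) (i : 'I_n) (x : int) : gen i (x + n%:Z) = gen i x + n%:Z.
Proof.
rewrite /gen.
have -> : x + n%:Z - (i : nat)%:Z = x - (i : nat)%:Z + n%:Z by lia.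
have -> : x - (i : nat)%:Z + n%:Z - 1 = x - (i : nat)%:Z - 1 + n%:Z by lia.
by rewrite !modzDr; case: ifP => _; [lia | case: ifP => _ //; lia].
Qed.

Lemma residue_inj (n : nat) (w : int -> int) (x y : 'I_n.+1) (t : int) :
  injective w -> (forall i : int, w (i + n.+1%:Z) = w i + n.+1%:Z) ->
  w (x : nat).+1%:Z = w (y : nat).+1%:Z + n.+1%:Z * t -> x = y.
Proof.
move=> winj per; rewrite -(is_affine_shift per) => /winj e.
have [] := @digit_uniq n x y 0 t (ltn_ord x) (ltn_ord y); first lia.
by move=> xy _; apply: val_inj.
Qed.

Lemma swap01_ltn (a b : nat) : ~~ ((a + b == 1)%N) -> (swap01 a < swap01 b)%N = (a < b)%N.
Proof. by case: a => [|[|a]]; case: b => [|[|b]]. Qed.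

(** Exchanging 0 and 1 reverses only the comparison between the two positions with these residues,
    so at most one term changes, by at most one. *)
Lemma digit_inversions_swap_le (n : nat) (q : 'I_n -> int) (r : 'I_n -> nat) :
  injective r ->
  (digit_inversions q (swap01 \o r) <= (digit_inversions q r).+1)%N.
Proof.
move=> rinj.
pose e (xy : 'I_n * 'I_n) : nat := ((r xy.2 + r xy.1 == 1)%N).
have le1 : (\sum_(xy : 'I_n * 'I_n | (xy.1 < xy.2)%N) e xy <= 1)%N.
  rewrite [X in (X <= _)%N](_ : _ = \sum_(xy : 'I_n * 'I_n | ((xy.1 < xy.2) && (r xy.2 + r xy.1 == 1))%N) 1)%N.
    rewrite sum1_card; apply/card_le1_eqP => -[x y] [x' y']; rewrite !unfold_in /=.
    move=> /andP[lt1 e1] /andP[lt2 e2].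
    have : (r x = r x' /\ r y = r y') \/ (r x = r y' /\ r y = r x') by lia.
    case=> -[] /rinj ? /rinj ?; subst=> //; lia.
  by rewrite big_mkcondr; apply: eq_bigr => xy _; rewrite /e; case: eqP.
apply: (@leq_trans (\sum_(xy : 'I_n * 'I_n | (xy.1 < xy.2)%N)
    (absz (q xy.2 - q xy.1 - (r xy.2 < r xy.1)%N%:Z)%R + e xy))%N); last first.
  by rewrite big_split /= -addn1 leq_add2l.
apply: leq_sum => -[x y] _ /=; rewrite /e /=; case: eqP => [_|/eqP ne]; first by lia.
by rewrite swap01_ltn //; lia.
Qed.

(** The last hypothesis fixes the sign inside the only term that changes, so that the swap moves it
    towards 0. *)
Lemma digit_inversions_swap_lt (n : nat) (q : 'I_n -> int) (r : 'I_n -> nat) (a b : 'I_n) :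
  injective r -> r a = 0%N -> r b = 1%N -> q a <= q b - (a <= b)%N%:Z ->
  (digit_inversions q (swap01 \o r) < digit_inversions q r)%N.
Proof.
move=> rinj ra rb qab.
have nab : a != b by apply/eqP => eab; move: ra; rewrite eab rb.
pose ab := if (a < b)%N then (a, b) else (b, a).
have ltab : (ab.1 < ab.2)%N.
  by rewrite /ab; case: (ltngtP a b) nab => // /val_inj ->; rewrite eqxx.
rewrite /digit_inversions (bigD1 ab) //= [X in (_ < X)%N](bigD1 ab) //=.
rewrite -addSn leq_add //.
  by rewrite /ab; case: (ltnP a b) => /=; rewrite ra rb /=; lia.
apply: leq_sum => -[x y] /= /andP[ltxy nexy]; rewrite swap01_ltn //.
apply: contra nexy => e1.
have : (r x = r a /\ r y = r b) \/ (r x = r b /\ r y = r a) by lia.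
by case=> -[] /rinj ? /rinj ?; subst; rewrite /ab; case: (ltnP a b) => //; lia.
Qed.

Lemma is_affine_digit (n : nat) (w : int -> int) (i : int) :
  is_affine_perm n.+1 w ->
  exists (q : 'I_n.+1 -> int) (r : 'I_n.+1 -> 'I_n.+1), injective r /\
    forall x : 'I_n.+1, w (x : nat).+1%:Z = i + ((r x : nat)%:Z + n.+1%:Z * q x).
Proof.
move=> [wbij per _].
have /choice[rq rqE] : forall x : 'I_n.+1, exists rq : 'I_n.+1 * int,
    w (x : nat).+1%:Z = i + ((rq.1 : nat)%:Z + n.+1%:Z * rq.2).
  move=> x; have [r [q e]] := digit_exists n (w (x : nat).+1%:Z - i).
  by exists (r, q) => /=; rewrite -e; lia.
exists (fun x => (rq x).2), (fun x => (rq x).1); split=> // x y e.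
apply: (@residue_inj n w x y ((rq x).2 - (rq y).2) (bij_inj wbij) per).
by rewrite !rqE e; lia.
Qed.

(** Counted from [i], the window takes every residue exactly once; exchanging 0 and 1 among them
    keeps the sum. *)
Lemma gen_sum (n : nat) (i : 'I_n.+2) (w : int -> int) :
  is_affine_perm n.+2 w -> 
  \sum_(1 <= j < n.+3) gen i (w j%:Z) = \sum_(1 <= j < n.+3) w j%:Z.
Proof.
move=> aw; have [q [r [rinj wE]]] := is_affine_digit (i : nat)%:Z aw.
rewrite !big_add1 /= !big_mkord.
under eq_bigr => x _ do rewrite wE gen_digit //.
under [RHS]eq_bigr => x _ do rewrite wE.
rewrite !big_split /=; congr (_ + (_ + _)).
have P (F : nat -> int) : \sum_(x < n.+2) F (r x) = \sum_(x < n.+2) F x.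
  by rewrite [RHS](reindex_inj rinj).
rewrite (P (fun x => (swap01 x)%:Z)) (P (fun x => x%:Z)).
by rewrite !big_ord_recl /= addrCA.
Qed.

Lemma gen_affine (n : nat) (i : 'I_n.+2) (w : int -> int) :
  is_affine_perm n.+2 w -> is_affine_perm n.+2 (gen i \o w).
Proof.
move=> aw; case: (aw) => wbij per wsum; split.
- by apply: bij_comp => //; exists (gen i); apply: genK.
- by move=> x /=; rewrite per gen_shift.
- by rewrite -wsum -(gen_sum i aw).
Qed.

Lemma inversions_gen (n : nat) (i : 'I_n.+2) (w : int -> int) (q : 'I_n.+2 -> int) (r : 'I_n.+2 -> 'I_n.+2) :
  (forall x : 'I_n.+2, w (x : nat).+1%:Z = (i : nat)%:Z + ((r x : nat)%:Z + n.+2%:Z * q x)) ->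
  inversions n.+2 (gen i \o w) = digit_inversions q (swap01 \o (val \o r)).
Proof.
move=> wE; apply: (@inversions_digit _ _ (i : nat)%:Z) => x /=.
  by case: (r x) => [[|[|m]]].
by rewrite wE gen_digit.
Qed.

Lemma inversions_id (n : nat) : inversions n.+1 id = 0%N.
Proof.
rewrite (@inversions_digit n id 1 (fun=> 0) (fun x => x)) => [|//|x]; last by lia.
by apply: big1 => -[x y] /= xy; lia.
Qed.


Lemma sum_window_id (n : nat) : \sum_(1 <= i < n.+1) i%:Z = ('C(n.+1, 2))%:Z.
Proof.
elim: n => [|n IH]; first by rewrite big_geq.
by rewrite big_nat_recr //= IH [in RHS]binS bin1 PoszD.
Qed.

Lemma id_affine (n : nat) : is_affine_perm n id.
Proof. by split=> //; [exists id | apply: sum_window_id]. Qed.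

Lemma gen_prod_affine (n : nat) (ws : seq 'I_n.+2) : is_affine_perm n.+2 (gen_prod ws).
Proof. by elim: ws => [|i ws IH] /=; [apply: id_affine | apply: gen_affine]. Qed.

Lemma inversions_gen_prod (n : nat) (ws : seq 'I_n.+2) :
  (inversions n.+2 (gen_prod ws) <= size ws)%N.
Proof.
elim: ws => [|i ws IH] /=; first by rewrite inversions_id.
have [q [r [rinj wE]]] := is_affine_digit (i : nat)%:Z (gen_prod_affine ws).
have rinj' : injective (val \o r) by apply: inj_comp => //; apply: val_inj.
rewrite (inversions_gen wE); apply: leq_trans (digit_inversions_swap_le _ rinj') _.
by rewrite ltnS (leq_trans _ IH) // (@inversions_digit _ _ (i : nat)%:Z q (val \o r)) //= => x.
Qed.

(** An increasing bijection of the integers is a translation, and the window sum excludes every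
    translation but the identity. *)
Lemma increasing_affine_id (n : nat) (w g : int -> int) :
  is_affine_perm n.+1 w -> cancel w g -> cancel g w ->
  (forall i : int, g i < g (i + 1)) -> w = id.
Proof.
move=> [_ per wsum] wK gK ginc.
have gmono (m : nat) (i : int) : g i < g (i + m.+1%:Z).
  elim: m => [|m IH]; first exact: ginc.
  by apply: lt_trans IH _; rewrite [X in _ < g X](_ : _ = i + m.+1%:Z + 1) ?ginc //; lia.
have glt (i j : int) : i < j -> g i < g j.
  move=> ij; have := gmono (absz (j - i)%R).-1 i; rewrite [X in _ < g X -> _](_ : _ = j) //; lia.
(* If [g] jumped over [g i + 1], the preimage of that value would lie strictly between [i] and
   [i + 1]. *)
have gS (i : int) : g (i + 1) = g i + 1.
  have le1 : g i + 1 <= g (i + 1) by have := ginc i; lia.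
  apply/eqP; rewrite eq_le le1 andbT leNgt; apply/negP => lt1.
  have h1 : i < w (g i + 1).
    rewrite ltNge; apply/negP; rewrite le_eqVlt => /orP[/eqP e|/glt].
      by have := wK (g i + 1); rewrite e; lia.
    by rewrite wK; lia.
  have : w (g i + 1) < i + 1.
    rewrite ltNge; apply/negP; rewrite le_eqVlt => /orP[/eqP e|/glt].
      by have := wK (g i + 1); rewrite -e; lia.
    by rewrite wK; lia.
  by lia.
have gN (m : nat) (i : int) : g (i + m%:Z) = g i + m%:Z.
  elim: m => [|m IH]; first by rewrite !addr0.
  by rewrite [X in g X](_ : _ = i + m%:Z + 1) ?gS ?IH; lia.
have gE (i : int) : g i = i + g 0.
  case: i => m; first by have := gN m 0; rewrite add0r addrC.
  by have := gN m.+1 (Negz m); rewrite [X in g X = _ -> _](_ : _ = 0); lia.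
have wE (x : int) : w x = x - g 0 by rewrite -{1}(subrK (g 0) x) -gE gK.
have : g 0 = 0.
  move: wsum; under eq_bigr => j _ do rewrite wE.
  rewrite big_split /= sum_window_id -[RHS]addr0 => /addrI.
  rewrite sumr_const_nat subn1 /=; move/eqP; rewrite mulrn_eq0 /= oppr_eq0.
  by move/eqP.
by move=> g0; apply: funext => x; rewrite wE g0 subr0.
Qed.

(** The inverse [g] of [w] is not increasing, so some value [i + 1] stands to the left of [i]; the
    generator exchanging them, applied on the left, lowers the count. *)
Lemma inversions_descent (n : nat) (w : int -> int) :
  is_affine_perm n.+2 w -> w <> id ->
  exists i : 'I_n.+2, (inversions n.+2 (gen i \o w) < inversions n.+2 w)%N.
Proof.
move=> aw nid; case: (aw) => -[g wK gK] per _.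
have gper (i q : int) : g (i + n.+2%:Z * q) = g i + n.+2%:Z * q.
  by apply: (can_inj wK); rewrite (is_affine_shift per) !gK.
have [i gi] : exists i : int, g (i + 1) < g i.
  apply: contrapT => /forallNP H; apply: nid; apply: (increasing_affine_id aw wK gK) => i.
  have /negP := H i; rewrite -leNgt le_eqVlt => /orP[/eqP /(can_inj gK)|//]; lia.
have [i0 [t e]] := digit_exists n.+1 i; exists i0.
have {gi e} gi : g ((i0 : nat)%:Z + 1) < g (i0 : nat)%:Z.
  move: gi; rewrite e gper [X in g X](_ : _ = (i0 : nat)%:Z + 1 + n.+2%:Z * t); last lia.
  by rewrite gper; lia.
have [q [r [rinj wE]]] := is_affine_digit (i0 : nat)%:Z aw.
have rinj' : injective (val \o r) by apply: inj_comp => //; apply: val_inj.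
rewrite (inversions_gen wE) (@inversions_digit _ w (i0 : nat)%:Z q (val \o r)) //=.
(* [a] and [b] are the window indices, counted from 0, at which translates of the values [i0] and
   [i0 + 1] stand. *)
have [a [s ea]] := digit_exists n.+1 (g (i0 : nat)%:Z - 1).
have [b [u eb]] := digit_exists n.+1 (g ((i0 : nat)%:Z + 1) - 1).
have wa : w (a : nat).+1%:Z = (i0 : nat)%:Z + (0 + n.+2%:Z * - s).
  have -> : (a : nat).+1%:Z = g (i0 : nat)%:Z + n.+2%:Z * - s by lia.
  by rewrite -gper gK; lia.
have wb : w (b : nat).+1%:Z = (i0 : nat)%:Z + (1 + n.+2%:Z * - u).
  have -> : (b : nat).+1%:Z = g ((i0 : nat)%:Z + 1) + n.+2%:Z * - u by lia.
  by rewrite -gper gK; lia.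
have [ra qa] := @digit_uniq n.+1 (r a) 0 (q a) (- s) (ltn_ord _) isT (addrI _ (etrans (esym (wE a)) wa)).
have [rb qb] := @digit_uniq n.+1 (r b) 1 (q b) (- u) (ltn_ord _) isT (addrI _ (etrans (esym (wE b)) wb)).
apply: (@digit_inversions_swap_lt _ _ _ a b) => //.
have := @ltz_digit n.+1 b a u s (ltn_ord _) (ltn_ord _); rewrite qa qb -ea -eb; lia.
Qed.

Lemma factors_in_inversions (n : nat) (w : int -> int) :
  is_affine_perm n.+2 w -> exists2 ws : seq 'I_n.+2, (size ws <= inversions n.+2 w)%N & w = gen_prod ws.
Proof.
have [m] := ubnP (inversions n.+2 w); elim: m w => // m IH w lem aw.
have [->|nid] := pselect (w = id); first by exists [::].
have [i lti] := inversions_descent aw nid.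
have [|ws sz e] := IH (gen i \o w) _ (gen_affine i aw); first lia.
exists (i :: ws) => /=; first lia.
by rewrite -e; apply: funext => x /=; rewrite genK.
Qed.

(** [inversions_gen_prod] bounds every word from below, and repeated descents give a word attaining
    the bound. *)
Lemma aff_length_inversions (n : nat) (w : int -> int) (k : nat) :
  is_affine_perm n.+2 w -> aff_length n.+2 w k <-> inversions n.+2 w = k.
Proof.
move=> aw; have [ws sz e] := factors_in_inversions aw.
have lb k' : factors_in n.+2 w k' -> (inversions n.+2 w <= k')%N.
  by move=> [vs [<- /funext ->]]; apply: inversions_gen_prod.
have fac : factors_in n.+2 w (inversions n.+2 w).
  exists ws; split=> [|j]; last by rewrite e.
  by apply/eqP; rewrite eqn_leq sz; apply: lb; exists ws; split=> // j; rewrite e.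
split=> [[fk mink]|<-].
  apply/eqP; rewrite eqn_leq (lb _ fk) leqNgt; apply/negP => /mink; exact.
by split=> // k' lt' /lb; rewrite leqNgt lt'.
Qed.

(** * Coordinates on affine permutations *)

(** [inord] never takes its default here, a residue modulo [n.+1] being below [n.+1]; the shifts by
    1 match a window that starts at position 1. *)
Definition affw (n : nat) (s : 'S_n.+1) (h : {ffun 'I_n.+1 -> int}) (x : int) : int :=
  let r : 'I_n.+1 := inord (absz ((x - 1)%R %% n.+1%:Z)%Z) in
  1 + ((s r : nat)%:Z + n.+1%:Z * (h r + ((x - 1) %/ n.+1%:Z)%Z)).

Lemma affwE (n : nat) (s : 'S_n.+1) (h : {ffun 'I_n.+1 -> int}) (j : 'I_n.+1) (q : int) :
  affw s h (1 + ((j : nat)%:Z + n.+1%:Z * q)) = 1 + ((s j : nat)%:Z + n.+1%:Z * (h j + q)).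
Proof.
rewrite /affw; set x := 1 + _ - 1.
have -> : x = (j : nat)%:Z + n.+1%:Z * q by rewrite /x; lia.
by rewrite modz_digit // divz_digit // absz_nat inord_val.
Qed.

Lemma affw_window (n : nat) (s : 'S_n.+1) (h : {ffun 'I_n.+1 -> int}) (j : 'I_n.+1) :
  affw s h (j : nat).+1%:Z = 1 + ((s j : nat)%:Z + n.+1%:Z * h j).
Proof.
have -> : (j : nat).+1%:Z = 1 + ((j : nat)%:Z + n.+1%:Z * 0) by lia.
by rewrite affwE addr0.
Qed.

Lemma pos_exists (n : nat) (x : int) :
  exists (j : 'I_n.+1) (q : int), x = 1 + ((j : nat)%:Z + n.+1%:Z * q).
Proof. by have [j [q e]] := digit_exists n (x - 1); exists j, q; rewrite -e; lia. Qed.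

(** The normalization of the window sum thus becomes [\sum_j h j = 0], the residues [s j] being a
    rearrangement of the indices. *)
Lemma sum_affw (n : nat) (s : 'S_n.+1) (h : {ffun 'I_n.+1 -> int}) :
  \sum_(1 <= i < n.+2) affw s h i%:Z = ('C(n.+2, 2))%:Z + n.+1%:Z * \sum_j h j.
Proof.
rewrite -sum_window_id !big_add1 /= !big_mkord.
rewrite (eq_bigr _ (fun j _ => affw_window s h j)).
rewrite big_split big_split /= addrA mulr_sumr; congr (_ + _).
rewrite [X in _ + X](_ : _ = \sum_(j < n.+1) (j : nat)%:Z); last first.
  by rewrite [RHS](reindex_inj (@perm_inj _ s)).
by rewrite -big_split; apply: eq_bigr => j _ /=; lia.
Qed.

Lemma affw_affine (n : nat) (s : 'S_n.+1) (h : {ffun 'I_n.+1 -> int}) :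
  \sum_j h j = 0 -> is_affine_perm n.+1 (affw s h).
Proof.
move=> h0; split; last by rewrite sum_affw h0 mulr0 addr0.
- have inj : injective (affw s h).
    move=> x y; have [a [q ->]] := pos_exists n x; have [b [u ->]] := pos_exists n y.
    rewrite !affwE => /addrI /(digit_uniq (ltn_ord _) (ltn_ord _)) [/val_inj /perm_inj -> e].
    by congr (_ + (_ + _ * _)); lia.
  have /choice[g gE] : forall y, exists x, affw s h x = y.
    move=> y; have [b [u ->]] := pos_exists n y.
    exists (1 + (((s^-1)%g b : nat)%:Z + n.+1%:Z * (u - h ((s^-1)%g b)))).
    by rewrite affwE permKV; congr (_ + (_ + _ * _)); lia.
  by exists g => x //; apply: inj; rewrite gE.
- move=> x; have [a [q ->]] := pos_exists n x.
  rewrite affwE [X in affw _ _ X](_ : _ = 1 + ((a : nat)%:Z + n.+1%:Z * (q + 1))); last lia.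
  by rewrite affwE; lia.
Qed.

Lemma affine_affw (n : nat) (w : int -> int) :
  is_affine_perm n.+1 w ->
  exists (s : 'S_n.+1) (h : {ffun 'I_n.+1 -> int}), \sum_j h j = 0 /\ w = affw s h.
Proof.
move=> aw; have [q [r [rinj wE]]] := is_affine_digit 1 aw.
exists (perm rinj), [ffun x => q x].
have e : w = affw (perm rinj) [ffun x => q x].
  apply: funext => x; have [a [u ->]] := pos_exists n x.
  rewrite affwE permE ffunE; case: aw => _ per _.
  have -> : 1 + ((a : nat)%:Z + n.+1%:Z * u) = (a : nat).+1%:Z + n.+1%:Z * u by lia.
  by rewrite (is_affine_shift per) wE; lia.
split=> //; case: aw => _ _; rewrite e sum_affw -[RHS]addr0 => /addrI /eqP.
by rewrite mulf_eq0 /= => /eqP.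
Qed.

(** Counting windows, as [coeff] does, is therefore counting pairs [(s, h)]. *)
Lemma window_affw_inj (n : nat) (s s' : 'S_n.+1) (h h' : {ffun 'I_n.+1 -> int}) :
  window n.+1 (affw s h) = window n.+1 (affw s' h') -> s = s' /\ h = h'.
Proof.
move=> /eq_in_map e.
have E (j : 'I_n.+1) : s j = s' j /\ h j = h' j.
  have : (j : nat).+1 \in iota 1 n.+1 by rewrite mem_iota; have := ltn_ord j; lia.
  move=> /e.
  rewrite !affw_window => /addrI /(digit_uniq (ltn_ord _) (ltn_ord _)) [/val_inj -> ->].
  by [].
by split; [apply/permP => j | apply/ffunP => j]; have [] := E j.
Qed.

Lemma inversions_affw (n : nat) (s : 'S_n.+1) (h : {ffun 'I_n.+1 -> int}) :
  inversions n.+1 (affw s h) = digit_inversions h (fun j => s j).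
Proof. by apply: (@inversions_digit _ _ 1) => [//|x]; rewrite affw_window. Qed.

(* An occurrence of [p], read through the residue class [c a] and the period
   [m a] of the position of each letter; [x <= y - (j <= i)] says that
   [(x, i)] precedes [(y, j)] lexicographically. *)
Definition tracks (k : nat) (p : 'S_k) (n : nat) (s : 'I_n -> nat) (h : 'I_n -> int) : Prop :=
  exists (c : {ffun 'I_k -> 'I_n}) (m : 'I_k -> int),
    (forall a b : 'I_k, (a < b)%N -> m a <= m b - (c b <= c a)%N%:Z) /\
    (forall a b : 'I_k, (p a < p b)%N ->
       h (c a) + m a <= h (c b) + m b - (s (c b) <= s (c a))%N%:Z).

(** [ltz_digit] makes each comparison of positions or values lexicographic. Constraints for
    [p a < p b] suffice, since distinct letters of [p] have distinct values. *)
Lemma contains_affw (k : nat) (p : 'S_k) (n : nat) (s : 'S_n.+1) (h : {ffun 'I_n.+1 -> int}) :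
  contains p (affw s h) <-> tracks p (fun j => s j : nat) h.
Proof.
split=> [[idx [inc ord]]|[c [m [inc ord]]]].
  have /choice[cm cmE] : forall a : 'I_k, exists cm : 'I_n.+1 * int,
      idx a = 1 + ((cm.1 : nat)%:Z + n.+1%:Z * cm.2).
    by move=> a; have [j [q e]] := pos_exists n (idx a); exists (j, q).
  exists [ffun a => (cm a).1], (fun a => (cm a).2); split=> a b lt_ab; rewrite !ffunE.
    have := inc a b lt_ab; rewrite !cmE ltrD2l ltz_digit //.
  have := ord a b; rewrite lt_ab !cmE !affwE ltrD2l ltz_digit //.
exists (fun a => 1 + ((c a : nat)%:Z + n.+1%:Z * m a)).
have lt_p a b : (p a < p b)%N -> affw s h (1 + ((c a : nat)%:Z + n.+1%:Z * m a)) <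
    affw s h (1 + ((c b : nat)%:Z + n.+1%:Z * m b)).
  by move=> /ord; rewrite !affwE ltrD2l ltz_digit.
split=> a b; first by move=> /inc; rewrite ltrD2l ltz_digit.
case: (ltngtP (p a) (p b)) => [/lt_p //|/lt_p /ltW|/val_inj /perm_inj ->].
  by rewrite leNgt => /negbTE.
by rewrite ltxx.
Qed.

Definition avoider (n k : nat) (p : 'S_k) (i : nat) (s : 'S_n.+1) (h : {ffun 'I_n.+1 -> int}) : Prop :=
  [/\ \sum_j h j = 0, ~ tracks p (fun j => s j : nat) h & digit_inversions h (fun j => s j) = i].

Lemma avoiderP (n k : nat) (p : 'S_k) (i : nat) (v : seq int) :
  (exists w, [/\ is_affine_perm n.+2 w, avoids p w, aff_length n.+2 w i & window n.+2 w = v]) <->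
  (exists s (h : {ffun 'I_n.+2 -> int}), avoider p i s h /\ v = window n.+2 (affw s h)).
Proof.
split=> [[w [aw av lw <-]]|[s [h [[h0 av li] ->]]]].
  have [s [h [h0 e]]] := affine_affw aw; exists s, h; split; last by rewrite e.
  split=> //; first by rewrite -contains_affw -e.
  by rewrite -inversions_affw -e; apply/(aff_length_inversions _ aw).
have aw := affw_affine s h0; exists (affw s h); split=> //.
  by rewrite /avoids contains_affw.
by apply/(aff_length_inversions _ aw); rewrite inversions_affw.
Qed.

(** * Containment as a combination of affine inequalities *)

Definition lin (n : nat) (u : {ffun 'I_n -> int}) (h : 'I_n -> int) : int := \sum_j u j * h j.

Definition ev (n : nat) (f : {ffun 'I_n -> int} * int) (h : 'I_n -> int) : int :=
  lin f.1 h + f.2.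

(** Such a form is unchanged when one constant is added to all coordinates, which later allows three
    coordinates to be recentred to sum zero. *)
Definition zero_sum (n : nat) (f : {ffun 'I_n -> int} * int) : bool := \sum_j f.1 j == 0.

Lemma ev_add (n : nat) (f g : {ffun 'I_n -> int} * int) (h : 'I_n -> int) :
  ev (f + g) h = ev f h + ev g h.
Proof.
rewrite /ev /lin /= addrACA -big_split; congr (_ + _).
by apply: eq_bigr => j _; rewrite ffunE mulrDl.
Qed.

Lemma zero_sum_add (n : nat) (f g : {ffun 'I_n -> int} * int) :
  zero_sum f -> zero_sum g -> zero_sum (f + g).
Proof.
move=> /eqP f0 /eqP g0; apply/eqP.
rewrite (eq_bigr (fun j => f.1 j + g.1 j)) => [|j _]; last by rewrite ffunE.
by rewrite big_split /= f0 g0.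
Qed.

(** All coefficients of the eliminated variable are units, so its bounds are integers and no
    rounding condition arises. *)
Lemma int_between (A B : seq int) :
  (forall a b, a \in A -> b \in B -> a <= b) ->
  exists v, (forall a, a \in A -> a <= v) /\ (forall b, b \in B -> v <= b).
Proof.
elim: A => [|a A IH] AB.
  elim: B {AB} => [|b B [v [_ IH]]]; first by exists 0.
  exists (Num.min v b); split=> // c; rewrite in_cons => /predU1P[->|/IH]; lia.
have [|v [vA vB]] := IH; first by move=> a' b Aa; apply: AB; rewrite in_cons Aa orbT.
exists (Num.max v a); split=> [a'|b Bb].
  by rewrite in_cons => /predU1P[->|/vA]; lia.
by have := vB b Bb; have := AB a b (mem_head _ _) Bb; lia.
Qed.

(* Fourier-Motzkin elimination, exact over the integers for difference constraints. *)
Lemma difference_elim (n K : nat) (S : seq (nat * nat * ({ffun 'I_n -> int} * int))) :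
  (forall c, c \in S -> [&& (c.1.1 < K)%N, (c.1.2 < K)%N & zero_sum c.2]) ->
  exists T : seq ({ffun 'I_n -> int} * int), (forall f, f \in T -> zero_sum f) /\
    forall h, (exists x : nat -> int, forall c, c \in S -> x c.1.1 - x c.1.2 <= ev c.2 h) <->
      (all (fun f => 0 <= ev f h) T).
Proof.
elim: K S => [|K IH] S Sb.
  exists [::]; split=> // h; split=> // _; exists (fun=> 0) => c /Sb.
  by rewrite ltn0.
have ltK (a : nat) : a != K -> (a < K.+1)%N -> (a < K)%N by lia.
have chain (a b c d e : int) : a - b <= d -> b - c <= e -> a - c <= d + e by lia.
(* Constraints are sorted by the place of the eliminated [x K]: upper bounds [U], lower bounds [L],
   both places [D] (no unknown remains), neither [O]. *)
pose U := [seq c <- S | (c.1.1 == K) && (c.1.2 != K)].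
pose L := [seq c <- S | (c.1.1 != K) && (c.1.2 == K)].
pose D := [seq c <- S | (c.1.1 == K) && (c.1.2 == K)].
pose O := [seq c <- S | (c.1.1 != K) && (c.1.2 != K)].
(* A lower bound added to an upper bound cancels [x K] and is again a difference constraint. *)
pose S' := O ++ [seq ((l.1.1, u.1.2), l.2 + u.2) | l <- L, u <- U].
have [|T [T0 TP]] := IH S'.
  move=> c; rewrite mem_cat => /orP[|/allpairsP[[l u] /= [lL uU ->]]] /=.
    rewrite mem_filter => /andP[/andP[n1 n2] /Sb /and3P[l1 l2 ->]]; rewrite andbT.
    by apply/andP; split; apply: ltK.
  move: lL uU; rewrite !mem_filter => /andP[/andP[n1 _] /Sb /and3P[l1 _ z1]].
  move=> /andP[/andP[_ n2] /Sb /and3P[_ l2 z2]]; rewrite zero_sum_add // andbT.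
  by apply/andP; split; apply: ltK.
exists ([seq c.2 | c <- D] ++ T); split=> [f|h].
  rewrite mem_cat => /orP[/mapP[c cD ->]|/T0 //].
  by move: cD; rewrite mem_filter => /andP[_ /Sb /and3P[]].
rewrite all_cat; split=> [[x xS]|/andP[/allP DP /TP [x xS']]].
  apply/andP; split.
    apply/allP => f /mapP[c]; rewrite mem_filter => /andP[/andP[/eqP e1 /eqP e2] cS] ->.
    by have := xS c cS; rewrite e1 e2 subrr.
  apply/TP; exists x => c; rewrite mem_cat => /orP[|/allpairsP[[l u] /= [lL uU ->]]] /=.
    by rewrite mem_filter => /andP[_ /xS].
  move: lL uU; rewrite !mem_filter => /andP[/andP[_ /eqP e1] /xS].
  rewrite e1 => x1 /andP[/andP[/eqP e2 _] /xS]; rewrite e2 ev_add; exact: chain x1.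
pose lo (c : nat * nat * ({ffun 'I_n -> int} * int)) := x c.1.1 - ev c.2 h.
pose up (c : nat * nat * ({ffun 'I_n -> int} * int)) := x c.1.2 + ev c.2 h.
have [|v [vL vU]] := @int_between (map lo L) (map up U).
  move=> a b /mapP[l lL ->] /mapP[u uU ->]; rewrite /lo /up.
  have /xS' /= : ((l.1.1, u.1.2), l.2 + u.2) \in S'.
    by rewrite mem_cat; apply/orP; right; apply/allpairsP; exists (l, u).
  by rewrite ev_add; lia.
exists (fun i => if i == K then v else x i) => c cS.
case: eqP => [/eqP e1|/eqP e1]; case: eqP => [/eqP e2|/eqP e2].
- rewrite subrr; apply: DP; apply/mapP; exists c => //.
  by rewrite mem_filter e1 e2.
- have /vU : up c \in map up U by apply: map_f; rewrite mem_filter e1 e2.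
  by rewrite /up lerBlDl.
- have /vL : lo c \in map lo L by apply: map_f; rewrite mem_filter e1 e2.
  by rewrite /lo lerBlDr lerBlDl.
- by apply: xS'; rewrite mem_cat mem_filter e1 e2 cS.
Qed.

Lemma lin_delta (n : nat) (i j : 'I_n) (h : 'I_n -> int) :
  lin [ffun x => (x == i)%:Z - (x == j)%:Z] h = h i - h j.
Proof.
rewrite /lin; under eq_bigr => x _ do rewrite ffunE mulrBl.
have D l : \sum_x (x == l)%:Z * h x = h l.
  by rewrite (bigD1 l) //= eqxx mul1r big1 ?addr0 // => x /negbTE ->; rewrite mul0r.
by rewrite sumrB !D.
Qed.

Lemma sum_delta (n : nat) (i j : 'I_n) :
  \sum_x [ffun x : 'I_n => (x == i)%:Z - (x == j)%:Z] x = 0 :> int.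
Proof.
have := lin_delta i j (fun=> 1); rewrite subrr => e; rewrite -[RHS]e.
by apply: eq_bigr => x _; rewrite mulr1.
Qed.

(** Once the residue classes [c] are fixed, only the periods [m] are unknown; they enter through
    differences, and [h] through [h (c b) - h (c a)]. *)
Lemma tracks_col_forms (k : nat) (p : 'S_k) (n : nat) (s : 'I_n -> nat) (c : {ffun 'I_k -> 'I_n}) :
  exists T : seq ({ffun 'I_n -> int} * int), (forall f, f \in T -> zero_sum f) /\
    forall h : 'I_n -> int,
    (exists m : 'I_k -> int,
      (forall a b : 'I_k, (a < b)%N -> m a <= m b - (c b <= c a)%N%:Z) /\
      (forall a b : 'I_k, (p a < p b)%N ->
       h (c a) + m a <= h (c b) + m b - (s (c b) <= s (c a))%N%:Z)) <->
    all (fun f => 0 <= ev f h) T.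
Proof.
pose z : {ffun 'I_n -> int} := [ffun=> 0].
pose d (i j : 'I_n) : {ffun 'I_n -> int} := [ffun x => (x == i)%:Z - (x == j)%:Z].
pose S := [seq ((val ab.1, val ab.2), (z, - (c ab.2 <= c ab.1)%N%:Z)) 
     | ab <- enum [pred ab : 'I_k * 'I_k | (ab.1 < ab.2)%N]] ++
  [seq ((val ab.1, val ab.2), (d (c ab.2) (c ab.1), - (s (c ab.2) <= s (c ab.1))%N%:Z))
     | ab <- enum [pred ab : 'I_k * 'I_k | (p ab.1 < p ab.2)%N]].
have evz h t : ev (z, t) h = t.
  by rewrite /ev /lin big1 ?add0r // => j _; rewrite ffunE mul0r.
have evd h i j t : ev (d i j, t) h = h i - h j + t by rewrite /ev lin_delta.
have [|T [T0 TP]] := @difference_elim n k S.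
  move=> e; rewrite mem_cat => /orP[] /mapP[[a b] _ ->] /=; rewrite !ltn_ord /=.
    by rewrite /zero_sum big1 // => j _; rewrite ffunE.
  by rewrite /zero_sum sum_delta.
exists T; split=> // h; rewrite -TP; split=> [[m [inc ord]]|[x xS]].
  (* The default 0 is never read: the constraints mention only indices below [k]. *)
  exists (fun i => oapp m 0 (insub i)) => e.
  rewrite mem_cat => /orP[] /mapP[[a b]]; rewrite mem_enum unfold_in /= => lt_ab ->; rewrite /= !valK /=.
    by rewrite evz; have := inc _ _ lt_ab; lia.
  by rewrite evd; have := ord _ _ lt_ab; lia.
exists (fun a => x a); split=> a b lt_ab.
  have /xS /= : ((val a, val b), (z, - (c b <= c a)%N%:Z)) \in S.
    by rewrite mem_cat; apply/orP; left; apply/mapP; exists (a, b); rewrite ?mem_enum.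
  by rewrite evz; lia.
have /xS /= : ((val a, val b), (d (c b) (c a), - (s (c b) <= s (c a))%N%:Z)) \in S.
  by rewrite mem_cat; apply/orP; right; apply/mapP; exists (a, b); rewrite ?mem_enum.
by rewrite evd; lia.
Qed.

(** There are finitely many pairs [(s, c)], so one finite list of signs decides containment for all
    [s]. *)
Lemma tracks_forms (k : nat) (p : 'S_k) (n : nat) :
  exists F : seq ({ffun 'I_n -> int} * int), (forall f, f \in F -> zero_sum f) /\
    forall (s : 'S_n) (h h' : 'I_n -> int),
      (forall f, f \in F -> (0 <= ev f h) = (0 <= ev f h')) ->
      tracks p (fun j => s j : nat) h -> tracks p (fun j => s j : nat) h'.
Proof.
have /choice[T TP] := fun sc : 'S_n * {ffun 'I_k -> 'I_n} =>
  tracks_col_forms p (fun j => sc.1 j : nat) sc.2.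
exists (flatten [seq T sc | sc <- enum {: 'S_n * {ffun 'I_k -> 'I_n}}]); split.
  move=> f /flatten_mapP[sc _]; exact: (TP sc).1.
move=> s h h' hh' [c tr]; exists c.
apply/((TP (s, c)).2 h'); move/((TP (s, c)).2 h): tr => /allP tr.
apply/allP => f fT; rewrite -hh' ?tr //.
by apply/flatten_mapP; exists (s, c) => //; rewrite mem_enum.
Qed.

(** * Avoiders of size 3 *)

(** Permutations of length [i] are products of words of length [i], of which there are finitely
    many. *)
Lemma coeff_exists (n k : nat) (p : 'S_k) (i : nat) : exists c, coeff n p i c.
Proof.
pose P v := exists w, [/\ is_affine_perm n w, avoids p w, aff_length n w i & window n w = v].
pose L := undup [seq v <- [seq window n (gen_prod ws) | ws : i.-tuple 'I_n] | `[< P v >]].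
exists (size L), L; split=> //; first exact: undup_uniq.
move=> v; rewrite mem_undup mem_filter; split=> [/andP[/asboolP //]|Pv].
rewrite asboolT //=; have [w [_ _ [[ws [sz /funext e]] _] <-]] := Pv.
have /eqP szb := sz; apply/mapP; exists (Tuple szb); first by rewrite mem_enum.
by rewrite e.
Qed.

Lemma coeff_uniq (n k : nat) (p : 'S_k) (i c c' : nat) : coeff n p i c -> coeff n p i c' -> c = c'.
Proof.
move=> [L [uL <- LP]] [L' [uL' <- LP']]; apply: perm_size; apply: uniq_perm => // v.
by apply/idP/idP => [/LP /LP'|/LP' /LP].
Qed.

Lemma periodic_bounded (n k : nat) (p : 'S_k) : periodic n p ->
  exists B : nat, forall (i : nat) (L : seq (seq int)), uniq L ->
    (forall v, v \in L -> exists w,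
       [/\ is_affine_perm n w, avoids p w, aff_length n w i & window n w = v]) ->
    (size L <= B)%N.
Proof.
move=> [N [i0 [N1 per]]]; have /choice[c cP] := @coeff_exists n k p.
(* The maximum includes [i0]: any later index is positive, so truncated subtraction of [N] strictly
   lowers it. *)
exists (\max_(i < i0.+1) c i)%N => i L uL LP.
have cB j : (c j <= \max_(i < i0.+1) c i)%N.
  have [m] := ubnP j; elim: m j => // m IH j ltj.
  case: (ltnP j i0.+1) => [jlt|i0j].
    exact: (@leq_bigmax _ (fun i : 'I_i0.+1 => c i) (Ordinal jlt)).
  have /(per j (ltnW i0j)) cjN := cP j.
  by rewrite (coeff_uniq cjN (cP (j - N)%N)); apply: IH; lia.
apply: leq_trans (cB i); have [L' [uL' <- L'P]] := cP i.
by apply: uniq_leq_size => // v /LP /L'P.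
Qed.

Lemma seq_bound (T : eqType) (s : seq T) (F : T -> int) :
  exists b : int, 0 <= b /\ forall x, x \in s -> F x <= b.
Proof.
elim: s => [|x s [b [b0 IH]]]; first by exists 0.
exists (Num.max b (F x)); split=> [|y]; first by lia.
by rewrite in_cons => /predU1P[->|/IH]; lia.
Qed.

Definition l1norm (n : nat) (u : {ffun 'I_n -> int}) : int := \sum_j `|u j|.

Lemma lin_bound (n : nat) (u : {ffun 'I_n -> int}) (h : 'I_n -> int) (b : int) :
  (forall j, `|h j| <= b) -> `|lin u h| <= l1norm u * b.
Proof.
move=> hb; apply: le_trans (ler_norm_sum _ _ _) _; rewrite mulr_suml.
by apply: ler_sum => j _; rewrite normrM ler_wpM2l.
Qed.

Lemma linD (n : nat) (u h v : {ffun 'I_n -> int}) (m : nat) :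
  lin u (h + v *+ m) = lin u h + m%:Z * lin u v.
Proof.
rewrite /lin mulr_sumr -big_split; apply: eq_bigr => j _ /=.
by rewrite ffunE ffunMnE mulrDr; congr (_ + _); rewrite -mulr_natl mulrCA natz.
Qed.

Lemma digit_inversions3 (q : 'I_3 -> int) (r : 'I_3 -> nat) (o1 o2 : 'I_3) :
  o1 = 1%N :> nat -> o2 = 2%N :> nat ->
  digit_inversions q r =
  (absz (q o1 - q ord0 - (r o1 < r ord0)%N%:Z)%R + absz (q o2 - q ord0 - (r o2 < r ord0)%N%:Z)%R
   + absz (q o2 - q o1 - (r o2 < r o1)%N%:Z)%R)%N.
Proof.
move=> v1 v2; rewrite /digit_inversions.
rewrite -(pair_big_dep xpredT (fun x y : 'I_3 => (x < y)%N)
  (fun x y => absz (q y - q x - (r y < r x)%N%:Z)%R)) /=.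
under eq_bigr => x _ do rewrite big_mkcond.
rewrite !big_ord_recl !big_ord0 /=.
have -> : lift ord0 (lift ord0 ord0) = o2 by apply: val_inj; apply: esym.
have -> : lift ord0 ord0 = o1 by apply: val_inj; apply: esym.
by rewrite /= ?v1 ?v2 /= ?addn0 ?add0n ?addnA.
Qed.

(** An avoider far from every hyperplane would yield [B + 1] avoiders of the same length, against
    the bound [B]. *)
Lemma bounded3_forms (k : nat) (p : 'S_k) : periodic 3 p ->
  exists (A : seq {ffun 'I_3 -> int}) (M : int),
    (forall u, u \in A -> u != 0 /\ \sum_j u j = 0) /\
    forall (s : 'S_3) (h : {ffun 'I_3 -> int}), \sum_j h j = 0 ->
      ~ tracks p (fun j => s j : nat) h -> exists2 u, u \in A & `|lin u h| <= M.
Proof.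
move=> /periodic_bounded[B Bd]; have [F [F0 FP]] := tracks_forms p 3.
pose d (ij : 'I_3 * 'I_3) : {ffun 'I_3 -> int} := [ffun x => (x == ij.1)%:Z - (x == ij.2)%:Z].
(* The forms deciding containment, together with the coordinate differences, whose signs control the
   length. *)
pose A := [seq f.1 | f <- F & f.1 != 0] ++ [seq d ij | ij <- enum [pred ij : 'I_3 * 'I_3 | ij.1 != ij.2]].
have [b1 [b10 b1P]] := @seq_bound _ F (fun f => `|f.2|).
have [b2 [b20 b2P]] := @seq_bound _ A (@l1norm 3).
(* [b1] covers constant terms, [b2 * 2 * B] the drift of a form over [B] steps with entries at most
   2, and the last summand keeps the coordinates in order throughout. *)
exists A, (b1 + b2 * 2 * B%:Z + 10 * (B%:Z + 1)); split.
  move=> u; rewrite mem_cat => /orP[] /mapP.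
    by case=> f; rewrite mem_filter => /andP[nz /F0 /eqP f0] ->.
  case=> -[i j]; rewrite mem_enum unfold_in /= => nij ->; split; last exact: sum_delta.
  apply: contra_neq nij => /ffunP /(_ i); rewrite /d !ffunE /= eqxx.
  by case: eqP.
move=> s h h0 av; apply: contrapT => /forall2NP nA.
have {nA} bigA u : u \in A -> b1 + b2 * 2 * B%:Z + 10 * (B%:Z + 1) < `|lin u h|.
  by move=> uA; case: (nA u) => // /negP; rewrite -ltNge.
have sep i j : i != j -> 10 * (B%:Z + 1) < `|h i - h j|.
  move=> nij; have /bigA : d (i, j) \in A.
    by rewrite mem_cat; apply/orP; right; apply: map_f; rewrite mem_enum.
  by have : 0 <= b2 * 2 * B%:Z; [rewrite !mulr_ge0 | rewrite /d lin_delta /=; lia].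
pose o1 := @Ordinal 3 1 isT; pose o2 := @Ordinal 3 2 isT.
(* With [mid] the middle coordinate, the outer two keep their distance, and what one gap to the
   middle loses the other gains: the length is constant. *)
pose v mid : {ffun 'I_3 -> int} := [ffun j => if j == mid then -2 else 1].
have E mid m j : (h + v mid *+ m) j = h j + (if j == mid then -2 else 1) * m%:Z.
  by rewrite ffunE ffunMnE ffunE; move: (if _ then _ else _) => x; rewrite -mulr_natr natz.
have [mid midP] : exists mid, forall m, (m <= B)%N ->
    digit_inversions (h + v mid *+ m) (fun j => s j) = digit_inversions h (fun j => s j).
  have s1 := sep o1 ord0 isT; have s2 := sep o2 ord0 isT; have s3 := sep o2 o1 isT.
  have [e|[e|e]] : (h ord0 < h o1 < h o2 \/ h o2 < h o1 < h ord0) \/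
      (h o1 < h ord0 < h o2 \/ h o2 < h ord0 < h o1) \/ (h ord0 < h o2 < h o1 \/ h o1 < h o2 < h ord0) by lia.
  - by exists o1 => m mB; rewrite !(@digit_inversions3 _ _ o1 o2) // !E /=; lia.
  - by exists ord0 => m mB; rewrite !(@digit_inversions3 _ _ o1 o2) // !E /=; lia.
  - by exists o2 => m mB; rewrite !(@digit_inversions3 _ _ o1 o2) // !E /=; lia.
pose L := [seq window 3 (affw s (h + v mid *+ m)) | m <- iota 0 B.+1].
have : (size L <= B)%N.
  apply: (Bd (digit_inversions h (fun j => s j))).
    rewrite map_inj_uniq ?iota_uniq // => m m' /window_affw_inj[_ /ffunP /(_ mid)].
    by rewrite !E eqxx; lia.
  move=> w /mapP[m]; rewrite mem_iota => mB ->.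
  apply/(@avoiderP 1); exists s, (h + v mid *+ m); split=> //; split.
  - under eq_bigr => j _ do rewrite ffunE ffunMnE.
    rewrite big_split /= h0 add0r sumrMnl.
    suff -> : \sum_j v mid j = 0 by rewrite mul0rn.
    by rewrite !big_ord_recl big_ord0 !ffunE; case: (mid) => [[|[|[|x]]]].
  - apply: contra_not av; apply: FP => f fF.
    have b1f := b1P f fF; rewrite /ev linD.
    have [fz|fnz] := eqVneq f.1 0.
      have L0 (g : {ffun 'I_3 -> int}) : lin f.1 g = 0.
        by rewrite fz; apply: big1 => j _; rewrite ffunE mul0r.
      by rewrite !L0 mulr0.
    have fA : f.1 \in A.
      by rewrite mem_cat; apply/orP; left; apply: map_f; rewrite mem_filter fnz.
    have := bigA _ fA; have := b2P _ fA.
    have : `|lin f.1 (v mid)| <= l1norm f.1 * 2.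
      by apply: lin_bound => j; rewrite ffunE; case: ifP.
    move: (f.2) (lin f.1 h) (lin f.1 (v mid)) (l1norm f.1) b1f => t x y z b1f y1 y2 y3.
    have my : `|m%:Z * y| <= b2 * 2 * B%:Z by rewrite normrM; nia.
    move: (m%:Z * y) (b2 * 2 * B%:Z) my y3 => y' c my y3; apply/idP/idP; lia.
  - by apply: midP; lia.
by rewrite size_map size_iota ltnn.
Qed.

(** * Three residue classes of an avoider *)

Lemma lin_add (n : nat) (u : {ffun 'I_n -> int}) (f g : 'I_n -> int) :
  lin u (fun j => f j + g j) = lin u f + lin u g.
Proof. by rewrite /lin -big_split; apply: eq_bigr => j _; rewrite mulrDr. Qed.

Lemma lin_scale (n : nat) (u : {ffun 'I_n -> int}) (c : int) (f : 'I_n -> int) :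
  lin u (fun j => c * f j) = c * lin u f.
Proof. by rewrite /lin mulr_sumr; apply: eq_bigr => j _; rewrite mulrCA. Qed.

Lemma lin_const (n : nat) (u : {ffun 'I_n -> int}) (c : int) :
  lin u (fun=> c) = (\sum_j u j) * c.
Proof. by rewrite /lin mulr_suml. Qed.

Lemma l1norm_ge0 (n : nat) (u : {ffun 'I_n -> int}) : 0 <= l1norm u.
Proof. exact: sumr_ge0. Qed.

Lemma rank_exists (n : nat) (t : 'I_n -> nat) : injective t ->
  exists r : 'I_n -> 'I_n, forall a b, (r a <= r b)%N = (t a <= t b)%N.
Proof.
move=> tinj; pose R a := [set b | (t b < t a)%N].
have Rlt a : (#|R a| < n)%N.
  rewrite -[X in (_ < X)%N](card_ord n) -cardsT; apply: proper_card.
  by apply/properP; split=> //; exists a => //; rewrite inE ltnn.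
have Rmono a b : (t a < t b)%N -> (#|R a| < #|R b|)%N.
  move=> ab; apply: proper_card; apply/properP; split.
    by apply/subsetP => c; rewrite !inE => /ltn_trans ->.
  by exists a; rewrite !inE ?ltnn.
exists (fun a => Ordinal (Rlt a)) => a b /=.
case: (ltngtP (t a) (t b)) => [/Rmono /ltnW //|/Rmono|/tinj ->]; last by rewrite leqnn.
by rewrite ltnNge => /negbTE.
Qed.

Lemma tracks_comp (k : nat) (p : 'S_k) (l n : nat) (i : 'I_l -> 'I_n) (s : 'I_n -> nat) (h : 'I_n -> int) :
  (forall a b : 'I_l, (a < b)%N -> (i a < i b)%N) ->
  tracks p (s \o i) (h \o i) -> tracks p s h.
Proof.
move=> imono [c [m [inc ord]]]; exists [ffun a => i (c a)], m.
have E (a b : 'I_l) : (i a <= i b)%N = (a <= b)%N.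
  case: (ltngtP a b) => [/imono /ltnW //|/imono|/val_inj ->]; last by rewrite leqnn.
  by rewrite ltnNge => /negbTE.
split=> a b lt_ab; rewrite !ffunE; first by rewrite E; apply: inc.
exact: ord.
Qed.

(* Standardization: only the relative order of the values matters, so three
   residue classes look like an affine permutation of size 3. *)
Lemma standardize3 (k : nat) (p : 'S_k) (t : 'I_3 -> nat) (g : 'I_3 -> int) :
  injective t ->
  exists (s : 'S_3) (h : {ffun 'I_3 -> int}) ,
    [/\ \sum_j h j = 0, tracks p (fun j => s j : nat) h -> tracks p t g &
        forall u : {ffun 'I_3 -> int}, \sum_j u j = 0 -> `|lin u g| <= `|lin u h| + 4 * l1norm u].
Proof.
move=> tinj; have [r rE] := rank_exists tinj.
have rinj : injective r.
  by move=> a b e; apply: tinj; apply/eqP; rewrite eqn_leq -!rE e !leqnn.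
(* Subtracting [S] makes the sum of [y] equal to 0 + 1 + 2, so the quotients [h] sum to zero. A
   common shift preserves the order of the values. *)
pose S := \sum_j g j; pose y a := (r a : nat)%:Z + 3 * g a - S.
have /choice[q qE] : forall a, exists q : 'I_3 * int, y a = (q.1 : nat)%:Z + 3%:Z * q.2.
  by move=> a; have [j [x e]] := digit_exists 2 (y a); exists (j, x).
have sinj : injective (fun a => (q a).1).
  move=> a b e; apply: rinj; apply: val_inj => /=.
  have := qE a; have := qE b; rewrite /y e; have := ltn_ord (r a); have := ltn_ord (r b); lia.
have rsum (f : 'I_3 -> 'I_3) : injective f -> \sum_j (f j : nat)%:Z = 3.
  move=> finj; rewrite -[LHS](@reindex_inj _ _ _ _ f xpredT (fun j => (j : nat)%:Z)) //.
  by rewrite !big_ord_recl big_ord0.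
exists (perm sinj), [ffun a => (q a).2]; split.
- have : \sum_a y a = 3.
    rewrite /y !big_split /= rsum // -mulr_sumr -/S sumr_const card_ord -mulr_natr; lia.
  under eq_bigr => a _ do rewrite qE.
  rewrite big_split /= rsum // -mulr_sumr.
  have -> : \sum_a [ffun a => (q a).2] a = \sum_a (q a).2 by apply: eq_bigr => a _; rewrite ffunE.
  by move: (\sum_a _) => x; lia.
- move=> [c [m [inc ord]]]; exists c, m; split=> // a b /ord.
  rewrite !ffunE !permE -!rE -(ltz_digit _ _ (ltn_ord (q (c a)).1) (ltn_ord (q (c b)).1)).
  rewrite -(ltz_digit _ _ (ltn_ord (r (c a))) (ltn_ord (r (c b)))).
  by have := qE (c a); have := qE (c b); rewrite /y; lia.
- move=> u u0.
  have e1 : lin u y = lin u (fun a => (r a : nat)%:Z) + 3 * lin u g.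
    by rewrite /y lin_add lin_add lin_scale lin_const u0; lia.
  have e2 : lin u y = lin u (fun a => ((q a).1 : nat)%:Z) + 3 * lin u [ffun a => (q a).2].
    rewrite (_ : y = fun a => ((q a).1 : nat)%:Z + 3 * (q a).2); last exact: funext.
    rewrite lin_add lin_scale; congr (_ + _ * _).
    by apply: eq_bigr => a _; rewrite ffunE.
  (* Both residue vectors have entries at most 2; this is the source of [4 * l1norm u]. *)
  have B (f : 'I_3 -> 'I_3) : `|lin u (fun a => (f a : nat)%:Z)| <= l1norm u * 2.
    by apply: lin_bound => a; have := ltn_ord (f a); lia.
  have := B r; have := B (fun a => (q a).1); have := l1norm_ge0 u.
  move: e1 e2; move: (lin u y) (lin u g) (lin u [ffun a => (q a).2]) (lin u _) (lin u _) (l1norm u) => *.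
  by lia.
Qed.

(** [A] and [M] come from size 3 alone, so they serve every [n]; standardizing the three classes
    only enlarges the bound. *)
Lemma triple_forms (k : nat) (p : 'S_k) : periodic 3 p ->
  exists (A : seq {ffun 'I_3 -> int}) (M : int),
    (forall u, u \in A -> u != 0 /\ \sum_j u j = 0) /\
    forall (n : nat) (s : 'S_n) (h : 'I_n -> int) (i : 'I_3 -> 'I_n),
      (forall a b : 'I_3, (a < b)%N -> (i a < i b)%N) ->
      ~ tracks p (fun j => s j : nat) h -> exists2 u, u \in A & `|lin u (h \o i)| <= M.
Proof.
move=> /bounded3_forms[A [M [A0 AP]]].
have [b [b0 bP]] := @seq_bound _ A (@l1norm 3).
exists A, (M + 4 * b); split=> // n s h i imono av.
have iinj : injective i.
  move=> x y e; apply: val_inj; case: (ltngtP x y) => [/imono|/imono|//]; by rewrite e ltnn.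
have tinj : injective (fun a => s (i a) : nat) by move=> x y /val_inj /perm_inj /iinj.
have [s' [h' [h0 tr bd]]] := standardize3 p (h \o i) tinj.
have [u uA le] : exists2 u, u \in A & `|lin u h'| <= M.
  by apply: (AP s') => // /tr; apply: contra_not av => tr3; apply: (@tracks_comp _ _ _ _ i (fun j => s j : nat) h imono).
exists u => //; apply: le_trans (bd u (A0 u uA).2) _.
by have := bP u uA; lia.
Qed.

(** * Rays of avoiders *)

(** One bound [M] for coefficients and defect replaces the finite list of relations and makes the
    condition symmetric in [x], [y], [z]. *)
Definition tri (M : nat) (x y z : int) : Prop :=
  exists a b c : int, [/\ a + b + c = 0, [|| a != 0, b != 0 | c != 0],
    [&& `|a| <= M%:Z, `|b| <= M%:Z & `|c| <= M%:Z] & `|a * x + b * y + c * z| <= M%:Z].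

Lemma tri_swapl (M : nat) (x y z : int) : tri M x y z -> tri M y x z.
Proof.
by move=> [a [b [c [h1 h2 h3 h4]]]]; exists b, a, c; split; [lia | lia | lia |];
  rewrite [b * y + _]addrC.
Qed.

Lemma tri_swapr (M : nat) (x y z : int) : tri M x y z -> tri M x z y.
Proof.
by move=> [a [b [c [h1 h2 h3 h4]]]]; exists a, c, b; split; [lia | lia | lia |];
  rewrite addrAC.
Qed.

Lemma avoider_tri (k : nat) (p : 'S_k) : periodic 3 p ->
  exists M : nat, forall (n : nat) (s : 'S_n) (h : 'I_n -> int),
    ~ tracks p (fun j => s j : nat) h ->
    forall i j l : 'I_n, i != j -> i != l -> j != l -> tri M (h i) (h j) (h l).
Proof.
move=> /triple_forms[A [M [A0 AP]]].
have [b [b0 bP]] := @seq_bound _ A (@l1norm 3).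
exists (absz M + absz b)%N => n s h av.
have sorted (i j l : 'I_n) : (i < j)%N -> (j < l)%N -> tri (absz M + absz b)%N (h i) (h j) (h l).
  move=> ij jl; pose t (a : 'I_3) := if a == ord0 then i else if a == ord_max then l else j.
  have [|u uA le] := AP n s h t _ av.
    by move=> [[|[|[|x]]] hx] [[|[|[|y]]] hy] //= _; rewrite /t /=; lia.
  have [u0 usum] := A0 u uA; have := bP u uA; rewrite /l1norm.
  pose o1 : 'I_3 := lift ord0 ord0.
  have oE : lift ord0 (lift ord0 ord0) = ord_max :> 'I_3 by apply: val_inj.
  have unz : [|| u ord0 != 0, u o1 != 0 | u ord_max != 0].
    apply: contraNT u0; rewrite !negb_or !negbK => /and3P[/eqP e0 /eqP e1 /eqP e2].
    apply/eqP/ffunP => x; rewrite ffunE.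
    have [->|[->|->]] // : x = ord0 \/ x = o1 \/ x = ord_max.
    by case: x => -[|[|[|x]]] hx; [left | right; left | right; right |]; rewrite // ; apply: val_inj.
  move: usum le; rewrite /lin !big_ord_recl !big_ord0 /= oE -/o1.
  have [-> -> ->] : [/\ t ord0 = i, t o1 = j & t ord_max = l] by [].
  rewrite !addr0 !addrA => usum le ub.
  exists (u ord0), (u o1), (u ord_max); split=> //.
    by move: (u ord0) (u o1) (u ord_max) ub => *; lia.
  by apply: le_trans le _; lia.
move=> i j l ij il jl.
case: (ltngtP i j) ij => [ij _|ji _|/val_inj ->]; last by rewrite eqxx.
- case: (ltngtP j l) jl => [jl _|lj _|/val_inj ->]; last by rewrite eqxx.
    exact: sorted.
  case: (ltngtP i l) il => [il _|li _|/val_inj ->]; last by rewrite eqxx.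
    by apply: tri_swapr; apply: sorted.
  by apply: tri_swapr; apply: tri_swapl; apply: sorted.
- case: (ltngtP i l) il => [il _|li _|/val_inj ->]; last by rewrite eqxx.
    by apply: tri_swapl; apply: sorted.
  case: (ltngtP j l) jl => [jl _|lj _|/val_inj ->]; last by rewrite eqxx.
    by apply: tri_swapl; apply: tri_swapr; apply: sorted.
  by apply: tri_swapl; apply: tri_swapr; apply: tri_swapl; apply: sorted.
Qed.

Lemma zero_sum_bound (n : nat) (h : 'I_n.+1 -> int) (j : 'I_n.+1) (K : int) :
  \sum_l h l = 0 -> (forall l, `|h l - h j| <= K) -> forall l, `|h l| <= 2 * K.
Proof.
move=> h0 hK l.
have e : n.+1%:Z * h j = - \sum_l (h l - h j).
  by rewrite sumrB h0 sumr_const card_ord -mulr_natr natz; lia.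
have : `|n.+1%:Z * h j| <= n.+1%:Z * K.
  rewrite e normrN; apply: le_trans (ler_norm_sum _ _ _) _.
  apply: le_trans (ler_sum _ (fun l _ => hK l)) _.
  by rewrite sumr_const card_ord -mulr_natr natz mulrC.
rewrite normrM ler_pM2l //; have := hK l; lia.
Qed.

(** The coefficient [c] of [z] cannot vanish, as [x - y] alone exceeds the defect. Solving for
    [z - y] divides by [c], and [c] divides [M!], a denominator common to all relations. *)
Lemma tri_slope (M : nat) (x y z : int) : M%:Z < x - y -> tri M x y z ->
  exists b e : int, [/\ (M`!)%:Z * (z - y) = e + b * (x - y),
    `|e| <= M%:Z * (M`!)%:Z & `|b| <= M%:Z * (M`!)%:Z].
Proof.
move=> big [a [b [c [abc nz /and3P[aM bM cM] le]]]].
have c0 : c != 0.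
  apply/eqP => c0; have ab : b = - a by lia.
  have a0 : a != 0 by move: nz; rewrite c0 ab; lia.
  move: le; rewrite c0 ab mul0r addr0 mulNr -mulrBr normrM.
  have a1 : 1 <= `|a| by lia.
  by nia.
have /dvdnP[d dE] : (absz c %| M`!)%N by apply: dvdn_fact; lia.
have [d' dE' d'M] : exists2 d' : int, (M`!)%:Z = c * d' & `|d'| <= (M`!)%:Z.
  by exists (sgz c * d%:Z); rewrite dE; nia.
exists (- (a * d')), (d' * (a * x + b * y + c * z)); split.
- by rewrite dE'; have -> : b = - a - c by [lia]; nia.
- by rewrite normrM; nia.
- by rewrite normrN normrM; nia.
Qed.

(** Relative to the smallest coordinate, every coordinate is, up to a bounded error, a bounded
    rational multiple of the spread [h i - h j]. *)
Lemma tri_ray (n M : nat) : exists B : int, forall h : {ffun 'I_n.+1 -> int},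
  \sum_j h j = 0 ->
  (forall i j l, i != j -> i != l -> j != l -> tri M (h i) (h j) (h l)) ->
  (forall j, `|h j| <= B) \/
  exists (r : {ffun 'I_n.+1 -> int}) (m : nat),
    [/\ \sum_j r j = 0, exists i j, r i != r j, forall j, `|r j| <= B &
        forall j, `|h j - r j * m%:Z| <= B].
Proof.
pose D := M`!; pose P := (n.+1 * D)%N; have D0 : (0 < D)%N := fact_gt0 M.
pose b := (M.+1 * D)%N.
(* The summands serve, in order, the distance to the ray, the size of [r], and the case of small
   spread. *)
pose B : int := 2 * (b%:Z + b%:Z * P%:Z) + 2 * n.+1%:Z * b%:Z + 2 * M%:Z.
exists B => h h0 htri.
pose i := [arg max_(i > ord0) h i]%O; pose j := [arg min_(j < ord0) h j]%O.
have hi l : h l <= h i by rewrite /i; case: arg_maxP => // x _; apply.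
have hj l : h j <= h l by rewrite /j; case: arg_minP => // x _; apply.
case: (lerP (h i - h j) M%:Z) => [small|big].
  left=> l; apply: le_trans (_ : 2 * M%:Z <= _); last by rewrite /B; nia.
  by apply: (@zero_sum_bound n h j) => // l'; have := hi l'; have := hj l'; lia.
right; have nij : i != j by apply/eqP => e; move: big; rewrite e subrr; lia.
(* [be l] is a slope and an error. The extreme indices get the exact slopes [D] and 0, which later
   give [r i != r j]. *)
have /choice[be beP] : forall l, exists be : int * int,
    [/\ D%:Z * (h l - h j) = be.2 + be.1 * (h i - h j), `|be.2| <= b%:Z, `|be.1| <= b%:Z,
        l = i -> be.1 = D%:Z & l = j -> be.1 = 0].
  move=> l; have [->|nli] := eqVneq l i.
    exists (D%:Z, 0); split=> //=; first lia.
    - by rewrite /b; nia.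
    - by move=> e; rewrite e eqxx in nij.
  have [->|nlj] := eqVneq l j.
    exists (0, 0); split=> //=; first by rewrite subrr; lia.
    by move=> e; move: nij; rewrite -e eqxx.
  have nil : i != l by rewrite eq_sym.
  have njl : j != l by rewrite eq_sym.
  have [x [e [E eM xM]]] := tri_slope big (htri i j l nij nil njl).
  exists (x, e); split=> //=; try by rewrite /b; nia.
  by move=> e'; rewrite e' eqxx in nli.
  by move=> e'; rewrite e' eqxx in nlj.
pose beta l := (be l).1; pose S := \sum_l beta l.
(* The slopes minus their mean, scaled by [n.+1] to stay integral. One step along [r] thus uses up
   [P] units of spread, and [m] counts the whole steps. *)
pose r : {ffun 'I_n.+1 -> int} := [ffun l => n.+1%:Z * beta l - S].
pose H := absz (h i - h j)%R; pose m := (H %/ P)%N.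
have HE : h i - h j = H%:Z by rewrite /H; lia.
have HP : H%:Z = P%:Z * m%:Z + (H %% P)%N%:Z by have := divn_eq H P; rewrite -/m; lia.
have modP : (H %% P < P)%N by rewrite ltn_mod muln_gt0.
have betaM l : `|beta l| <= b%:Z by have [] := beP l.
have betai : beta i = D%:Z by have [_ _ _ /(_ erefl)] := beP i.
have betaj : beta j = 0 by have [_ _ _ _ /(_ erefl)] := beP j.
have SM : `|S| <= n.+1%:Z * b%:Z.
  apply: le_trans (ler_norm_sum _ _ _) _; apply: le_trans (ler_sum _ (fun l _ => betaM l)) _.
  by rewrite sumr_const card_ord -mulr_natr natz mulrC.
have r0 : \sum_l r l = 0.
  under eq_bigr => l _ do rewrite ffunE.
  by rewrite sumrB -mulr_sumr sumr_const card_ord -mulr_natr natz mulrC subrr.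
exists r, m; split=> //.
- by exists i, j; rewrite !ffunE betai betaj; nia.
- move=> l; rewrite ffunE; apply: (@le_trans _ _ (2 * n.+1%:Z * b%:Z)); last by rewrite /B; nia.
  by have := betaM l; nia.
move=> l; apply: le_trans (_ : 2 * (b%:Z + b%:Z * P%:Z) <= _); last by rewrite /B; nia.
apply: (@zero_sum_bound n (fun l => h l - r l * m%:Z) j).
  by rewrite sumrB h0 -mulr_suml r0 mul0r subrr.
move=> {}l; have [E eM _ _ _] := beP l.
have {}E : D%:Z * (h l - r l * m%:Z - (h j - r j * m%:Z)) = (be l).2 + beta l * (H %% P)%N%:Z.
  have -> : D%:Z * (h l - r l * m%:Z - (h j - r j * m%:Z))
    = D%:Z * (h l - h j) - D%:Z * m%:Z * (r l - r j) by lia.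
  rewrite E !ffunE betaj HE HP /P -/(beta l) PoszM; lia.
have : `|(be l).2 + beta l * (H %% P)%N%:Z| <= b%:Z + b%:Z * P%:Z.
  apply: le_trans (ler_normD _ _) _; rewrite lerD // normrM ler_pM //; lia.
by rewrite -E normrM; apply: le_trans; rewrite ler_peMl //; lia.
Qed.

Lemma digit_inversions_bound (n : nat) (q : 'I_n -> int) (r : 'I_n -> nat) (b : nat) :
  (forall j, `|q j| <= b%:Z) -> (digit_inversions q r <= n * n * (2 * b + 1))%N.
Proof.
move=> qb; apply: (@leq_trans (\sum_(xy : 'I_n * 'I_n) (2 * b + 1))%N).
  rewrite /digit_inversions big_mkcond; apply: leq_sum => -[x y] _ /=.
  by case: ifP => // _; have := qb x; have := qb y; lia.
by rewrite sum_nat_const card_prod card_ord.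
Qed.

(** With all residues equal the corrections vanish: this is the sum of [|r y - r x|] over pairs, the
    length gained per step far out along [r]. *)
Definition slope (n : nat) (r : {ffun 'I_n -> int}) : nat := digit_inversions r (fun=> 0%N).

Lemma slope_gt0 (n : nat) (r : {ffun 'I_n -> int}) (i j : 'I_n) : r i != r j -> (0 < slope r)%N.
Proof.
move=> rij; wlog ltij : i j rij / (i < j)%N.
  case: (ltngtP i j) => [lt H|lt H|/val_inj e _]; first exact: (H i j).
    by apply: (H j i); rewrite // eq_sym.
  by rewrite e eqxx in rij.
by rewrite /slope /digit_inversions (bigD1 (i, j)) //= addn_gt0; apply/orP; left; lia.
Qed.

Lemma slopeMn (n : nat) (r : {ffun 'I_n -> int}) (c : nat) : slope (r *+ c) = (c * slope r)%N.
Proof.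
rewrite /slope /digit_inversions big_distrr /=; apply: eq_bigr => xy _.
by rewrite !ffunMnE !subr0 -mulrnBl -mulr_natl natz abszM absz_nat.
Qed.

(* [h] is within [B] of the [m]-th point of the ray of [r], a step of which
   increases the length by [N]. *)
Definition onray (n B N : nat) (h r : {ffun 'I_n -> int}) (m : nat) : Prop :=
  [/\ \sum_j r j = 0, slope r = N, forall j, `|r j| <= B%:Z & forall j, `|h j - r j * m%:Z| <= B%:Z].

(** Replacing [r] by a multiple [r *+ c] gives all rays the same slope [N]; the remainder of [m]
    modulo [c] goes into the enlarged bound. *)
Lemma avoider_ray (n k : nat) (p : 'S_k) : periodic 3 p ->
  exists B N : nat, (0 < N)%N /\ forall (s : 'S_n.+1) (h : {ffun 'I_n.+1 -> int}),
    \sum_j h j = 0 -> ~ tracks p (fun j => s j : nat) h ->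
    (forall j, `|h j| <= B%:Z) \/ exists r m, onray B N h r m.
Proof.
move=> /avoider_tri[M MP]; have [B BP] := tri_ray n M.
(* A factorial of a bound on all slopes, hence divisible by each of them. *)
pose b := absz B; pose N := (n.+1 * n.+1 * (2 * b + 1))`!.
exists (b + N * b)%N, N; split=> [|s h h0 av]; first exact: fact_gt0.
have [hB|[r [m [r0 [i [j rij]] rB hB]]]] := BP h h0 (MP _ s h av).
  by left=> j; have := hB j; rewrite /b; nia.
right; have rb l : `|r l| <= b%:Z by have := rB l; rewrite /b; lia.
have sl0 := slope_gt0 rij.
have /dvdnP[c cE] : (slope r %| N)%N by apply: dvdn_fact; rewrite sl0 digit_inversions_bound.
have c0 : (0 < c)%N by have : (0 < N)%N := fact_gt0 _; rewrite cE; case: (c).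
have cN : (c <= N)%N by rewrite cE leq_pmulr.
have E l : (r *+ c) l = r l * c%:Z by rewrite ffunMnE -mulr_natr natz.
exists (r *+ c), (m %/ c)%N; split.
- under eq_bigr => l _ do rewrite E.
  by rewrite -mulr_suml r0 mul0r.
- by rewrite slopeMn cE.
- by move=> l; rewrite E normrM; have := rb l; nia.
- move=> l; rewrite E.
  have -> : h l - r l * c%:Z * (m %/ c)%N%:Z = (h l - r l * m%:Z) + r l * (m %% c)%N%:Z.
    by have := divn_eq m c; nia.
  have mc : (m %% c < c)%N by rewrite ltn_mod.
  apply: le_trans (ler_normD _ _) _; rewrite PoszD lerD //.
    by have := hB l; rewrite /b; lia.
  by rewrite normrM; have := rb l; nia.
Qed.

(** * The bijection along the rays *)

Lemma onrayS (n B N m : nat) (h r : {ffun 'I_n -> int}) :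
  onray B N h r m <-> onray B N (h + r) r m.+1.
Proof.
have E j : (h + r) j - r j * m.+1%:Z = h j - r j * m%:Z.
  by rewrite ffunE; move: (h j) (r j) => x y; lia.
by split=> -[r0 rN rB hB]; split=> // j; have := hB j; rewrite E.
Qed.

(** Where [r] differs at [x] and [y], its multiple by [m] outweighs the offsets and the correction,
    so the sign is fixed and the term grows by [|r y - r x|]. Elsewhere it is unchanged. *)
Lemma digit_inversions_ray (n B N m : nat) (h r : {ffun 'I_n -> int}) (s : 'I_n -> nat) :
  onray B N h r m -> (2 * B + 2 <= m)%N ->
  digit_inversions (h + r) s = (digit_inversions h s + N)%N.
Proof.
move=> [_ <- _ hB] mB; rewrite /slope /digit_inversions -big_split; apply: eq_bigr => -[x y] _ /=.
have := hB x; have := hB y; rewrite !ffunE ?subr0.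
move: (h x) (h y) (r x) (r y) => hx hy rx ry h1 h2.
have e : hy - hx = (hy - ry * m%:Z - (hx - rx * m%:Z)) + (ry - rx) * m%:Z by lia.
have [e0|e0|e0] := ltgtP (ry - rx) 0.
- have : (ry - rx) * m%:Z <= - m%:Z by nia.
  by move: ((ry - rx) * m%:Z) e => *; lia.
- have : m%:Z <= (ry - rx) * m%:Z by nia.
  by move: ((ry - rx) * m%:Z) e => *; lia.
- by lia.
Qed.

Lemma ev_sign_ray (X t Y m : int) : `|X| + `|t| < m ->
  (0 <= X + Y * m + t) = (0 <= X + Y * (m + 1) + t).
Proof.
move=> lt; have [Y0|Y0|->] := ltgtP Y 0; last by rewrite !mul0r.
- have h1 : Y * m <= - m by nia.
  have h2 : Y * (m + 1) <= - m by nia.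
  by move: (Y * m) (Y * (m + 1)) h1 h2 => a b h1 h2; apply/idP/idP; lia.
- have h1 : m <= Y * m by nia.
  have h2 : m <= Y * (m + 1) by nia.
  by move: (Y * m) (Y * (m + 1)) h1 h2 => a b h1 h2; apply/idP/idP; lia.
Qed.

(** Along a ray each form is affine in [m], so far out its sign no longer changes. *)
Lemma tracks_ray (k : nat) (p : 'S_k) (n B N : nat) :
  exists m0 : nat, forall (s : 'S_n) (h r : {ffun 'I_n -> int}) (m : nat),
    (m0 <= m)%N -> onray B N h r m ->
    (tracks p (fun j => s j : nat) h <-> tracks p (fun j => s j : nat) (h + r)).
Proof.
have [F [_ FP]] := tracks_forms p n.
have [b [b0 bP]] := @seq_bound _ F (fun f => l1norm f.1 * B%:Z + `|f.2|).
exists (absz b).+1 => s h r m bm [_ _ _ hB].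
have sgn f : f \in F -> (0 <= ev f h) = (0 <= ev f (h + r)).
  move=> /bP fb; pose g : {ffun 'I_n -> int} := [ffun j => h j - r j * m%:Z].
  have gB : `|lin f.1 g| <= l1norm f.1 * B%:Z by apply: lin_bound => j; rewrite ffunE.
  have e1 : h = g + r *+ m.
    by apply/ffunP => j; rewrite ffunE ffunMnE ffunE -mulr_natr natz subrK.
  have e2 : h + r = g + r *+ m.+1 by rewrite e1 mulrSr addrA.
  rewrite e2 {1}e1 /ev !linD ![_%:Z * _]mulrC.
  have -> : m.+1%:Z = m%:Z + 1 by lia.
  move: (f.2) (lin f.1 g) (lin f.1 r) (l1norm f.1 * B%:Z) fb gB => t X Y c fb gB.
  by apply: ev_sign_ray; lia.
by split; apply: FP => f fF; rewrite sgn.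
Qed.

(** Since [slope h] does not mention the ray, this recovers [m] from [h] up to a bounded error. *)
Lemma slope_ray (n B N m : nat) (h r : {ffun 'I_n -> int}) : onray B N h r m ->
  (slope h <= m * N + n * n * (2 * B + 1))%N /\ (m * N <= slope h + n * n * (2 * B + 1))%N.
Proof.
move=> [_ <- _ hB].
have K : (\sum_(xy : 'I_n * 'I_n | (xy.1 < xy.2)%N) (2 * B + 1) <= n * n * (2 * B + 1))%N.
  rewrite sum_nat_const leq_mul2r; apply/orP; right.
  by rewrite (leq_trans (max_card _)) // card_prod card_ord.
have T (x y : 'I_n) : `|(h y - h x) - m%:Z * (r y - r x)| <= 2 * B%:Z.
  by have := hB x; have := hB y; lia.
rewrite /slope /digit_inversions big_distrr /=.
split; apply: leq_trans (leq_add (leqnn _) K); rewrite -big_split; apply: leq_sum => -[x y] _ /=;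
  by have := T x y; rewrite !subr0 -[m in (m * _)%N]absz_nat -abszM; lia.
Qed.

(** By [slope_ray], [m] and [m'] differ by at most [2 * K]; then [m] times each entry of [r - r'] is
    smaller than [m], forcing it to be 0. *)
Lemma onray_uniq (n B N m m' : nat) (h r r' : {ffun 'I_n -> int}) : (0 < N)%N ->
  onray B N h r m -> onray B N h r' m' ->
  (2 * B + 2 * (n * n * (2 * B + 1)) * B < m)%N -> r = r'.
Proof.
move=> N0 or or' big.
have [s1 s2] := slope_ray or; have [s1' s2'] := slope_ray or'.
move: (n * n * (2 * B + 1))%N big s1 s2 s1' s2' => K big s1 s2 s1' s2'.
have mm1 : (m <= m' + 2 * K)%N.
  rewrite leqNgt; apply/negP => lt; have : ((m' + 2 * K + 1) * N <= m * N)%N by rewrite leq_mul2r; lia.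
  by nia.
have mm2 : (m' <= m + 2 * K)%N.
  rewrite leqNgt; apply/negP => lt; have : ((m + 2 * K + 1) * N <= m' * N)%N by rewrite leq_mul2r; lia.
  by nia.
case: or => _ _ rB hB; case: or' => _ _ rB' hB'; apply/ffunP => j.
have := hB j; have := hB' j; have := rB' j.
move: (h j) (r j) (r' j) => x y z zB h2 h1.
have d : `|(m'%:Z - m%:Z) * z| <= 2 * K%:Z * B%:Z by rewrite normrM ler_pM //; lia.
have e : `|(y - z) * m%:Z| <= 2 * B%:Z + 2 * K%:Z * B%:Z.
  have -> : (y - z) * m%:Z = (x - z * m'%:Z) - (x - y * m%:Z) + (m'%:Z - m%:Z) * z by lia.
  by move: ((m'%:Z - m%:Z) * z) d => *; lia.
apply/eqP; rewrite -subr_eq0 -normr_le0 leNgt; apply/negP => yz.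
have : m%:Z <= `|(y - z) * m%:Z| by rewrite normrM ler_peMl //; lia.
by lia.
Qed.

Lemma ray_large (n B N m m0 : nat) (h : {ffun 'I_n -> int}) (s : 'I_n -> nat) (r : {ffun 'I_n -> int}) :
  onray B N h r m -> (n * n * (2 * (B + m0 * B) + 1) < digit_inversions h s)%N -> (m0 < m)%N.
Proof.
move=> [_ _ rB hB]; apply: contraTltn => mm0; rewrite -leqNgt.
apply: digit_inversions_bound => j.
have : `|r j * m%:Z| <= B%:Z * m0%:Z by rewrite normrM ler_pM //; have := rB j; lia.
by have := hB j; move: (r j * m%:Z) => *; lia.
Qed.

(** The bijection is given as a relation, so that no direction [r] has to be chosen for each
    avoider. *)
Lemma list_transfer (T : eqType) (P Q : T -> Prop) (R : T -> T -> Prop) (c : nat) :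
  (forall v, P v -> exists v', Q v' /\ R v v') ->
  (forall v', Q v' -> exists v, P v /\ R v v') ->
  (forall v v1 v2, R v v1 -> R v v2 -> v1 = v2) ->
  (forall v1 v2 v, R v1 v -> R v2 v -> v1 = v2) ->
  (exists L : seq T, [/\ uniq L, size L = c & forall v, v \in L <-> P v]) ->
  exists L : seq T, [/\ uniq L, size L = c & forall v, v \in L <-> Q v].
Proof.
move=> PQ QP fn inj [L [uL sL LP]].
have /choice[f fP] : forall v, exists v', P v -> Q v' /\ R v v'.
  by move=> v; have [/PQ[v' v'P]|nP] := pselect (P v); [exists v' | exists v].
exists [seq f v | v <- L]; split; last 1 first.
- move=> v'; split=> [/mapP[v /LP /fP[Qv _] ->] //|/QP[v [Pv Rv]]].
  by apply/mapP; exists v; [apply/LP | apply: fn Rv (fP v Pv).2].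
- rewrite map_inj_in_uniq // => x y /LP /fP[_ Rx] /LP /fP[_ Ry] e.
  by apply: inj Rx _; rewrite e.
- by rewrite size_map.
Qed.

Lemma periodic3_periodic (n k : nat) (p : 'S_k) : periodic 3 p -> periodic n.+2 p.
Proof.
move=> /(avoider_ray n.+1)[B [N [N0 ray]]]; have [m0 trm0] := tracks_ray p n.+2 B N.
(* Beyond [m1], containment is stable, the length grows by exactly [N], and the direction is
   unique. *)
pose m1 := (m0 + (2 * B + 2) + (2 * B + 2 * (n.+2 * n.+2 * (2 * B + 1)) * B))%N.
(* Length above [i1] forces a ray index above [m1]. *)
pose i1 := (n.+2 * n.+2 * (2 * (B + m1 * B) + 1))%N.
have far (s : 'S_n.+2) h i : avoider p i s h -> (i1 < i)%N -> exists r m, (m1 < m)%N /\ onray B N h r m.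
  move=> [h0 av <-] lt; have [hB|[r [m or]]] := ray s h h0 av.
    have : (digit_inversions h (fun j => s j) <= i1)%N.
      by apply: digit_inversions_bound => j; have := hB j; lia.
    by rewrite leqNgt lt.
  by exists r, m; split=> //; apply: ray_large or lt.
have step (s : 'S_n.+2) (h r : {ffun 'I_n.+2 -> int}) m i : (m1 <= m)%N -> onray B N h r m ->
    avoider p i s h <-> avoider p (i + N) s (h + r).
  move=> mm or; rewrite /avoider (@digit_inversions_ray _ B N m) //; last by rewrite /m1 in mm; lia.
  have tE : tracks p (fun j => s j : nat) h <-> tracks p (fun j => s j : nat) (h + r).
    by apply: (trm0 s h r m _ or); rewrite /m1 in mm; lia.
  have -> : \sum_j (h + r) j = \sum_j h j.
    under eq_bigr => j _ do rewrite ffunE.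
    by case: or => r0 _ _ _; rewrite big_split /= r0 addr0.
  by split=> -[? ? ?]; split=> //; [move/tE | lia | move/tE | lia].
(* This start makes [i - N] exceed [i1] too, so both ends of the bijection are far out. *)
exists N, (i1 + N + 1)%N; split=> // i ii c.
pose R (v v' : seq int) := exists (s : 'S_n.+2) (h r : {ffun 'I_n.+2 -> int}) m, [/\ (m1 <= m)%N, onray B N h r m,
  v = window n.+2 (affw s h) & v' = window n.+2 (affw s (h + r))].
have big m : (m1 <= m)%N -> (2 * B + 2 * (n.+2 * n.+2 * (2 * B + 1)) * B < m)%N by rewrite /m1; lia.
have fn v v1 v2 : R v v1 -> R v v2 -> v1 = v2.
  move=> [s [h [r [m [mm or -> ->]]]]] [s' [h' [r' [m' [_ or' e ->]]]]].
  have [es eh] := window_affw_inj e; subst s' h'.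
  by rewrite (onray_uniq N0 or or' (big m mm)).
(* [h + r] lies on the same ray with index [m.+1], so it too determines [r]. *)
have inj v1 v2 v : R v1 v -> R v2 v -> v1 = v2.
  move=> [s [h [r [m [mm or -> ->]]]]] [s' [h' [r' [m' [_ or' -> e]]]]].
  have [es eh] := window_affw_inj e; subst s'.
  move/onrayS: or => or; move/onrayS: or' => or'; rewrite -eh in or'.
  have er := onray_uniq N0 or or' (big _ (leqW mm)); subst r'.
  by rewrite (addIr _ eh).
pose A i v := exists s (h : {ffun 'I_n.+2 -> int}), avoider p i s h /\ v = window n.+2 (affw s h).
have down v : A (i - N)%N v -> exists v', A i v' /\ R v v'.
  move=> [s [h [av ->]]]; have [|r [m [mm or]]] := far s h _ av; first lia.
  exists (window n.+2 (affw s (h + r))); split; last by exists s, h, r, m; rewrite ltnW.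
  exists s, (h + r); split=> //; have -> : i = (i - N + N)%N by lia.
  by apply/(step s h r m (i - N)%N (ltnW mm) or).
have up v' : A i v' -> exists v, A (i - N)%N v /\ R v v'.
  (* The strict bound [m1 < m.+1] leaves the predecessor [h' - r] with an index [m] at least
     [m1]. *)
  move=> [s [h' [av ->]]]; have [|r [[|m] [mm or]]] // := far s h' _ av; first lia.
  have e : h' = h' - r + r by rewrite subrK.
  move: av or; rewrite e; move: (h' - r) => h av /(onrayS _ _ _ _ _).2 or.
  have {}mm : (m1 <= m)%N by rewrite -ltnS.
  exists (window n.+2 (affw s h)); split; last by exists s, h, r, m.
  exists s, h; split=> //; apply/(step s h r m (i - N)%N mm or).
  by have -> : (i - N + N)%N = i by lia.
have AE j v : (exists w, [/\ is_affine_perm n.+2 w, avoids p w, aff_length n.+2 w j & window n.+2 w = v])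
  <-> A j v := @avoiderP n k p j v.
have coeffE j : coeff n.+2 p j c <->
    exists L : seq (seq int), [/\ uniq L, size L = c & forall v, v \in L <-> A j v].
  by split=> -[L [uL sL LP]]; exists L; split=> // v; rewrite LP AE.
rewrite !coeffE; split; last exact: list_transfer down up fn inj.
apply: (@list_transfer _ _ _ (fun v v' => R v' v)) => //.
- by move=> v v1 v2; apply: inj.
- by move=> v1 v2 v; apply: fn.
Qed.

Theorem mainTheorem15 (n : nat) (hn : (3 < n)%N) (k : nat) (p : 'S_k) :
  periodic 3 p -> periodic n p.
Proof. by case: n hn => [|[|n]] // _; apply: periodic3_periodic. Qed.
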